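(* Let $G$ be a finite, simple, undirected graph with $n$ vertices, average degree $d$, degree deviation $s$ with $s>0$, and spectral radius $\lambda$. Then $$\lambda \ge d + \frac{\sqrt{2}\, s^{2}}{2 n^{2} \sqrt{d n}}.$$
   Context: For a graph $G$ with vertex set $V(G)$, $n$ vertices and $m$ edges, the average degree is $d=\frac{2m}{n}$ and the degree deviation is $s=\sum_{u\in V(G)}|d_G(u)-d|$, where $d_G(u)$ is the degree of $u$ in $G$. The spectral radius $\lambda$ is the largest eigenvalue of the adjacency matrix of $G$. *)

(* Defs.v *)
From mathcomp Require Import all_boot all_order all_algebra.
From mathcomp Require Import reals.

Set Implicit Arguments.
Unset Strict Implicit.
Unset Printing Implicit Defensive.

Import Order.TTheory GRing.Theory Num.Theory.
Local Open Scope ring_scope.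

(* A finite simple undirected graph is a symmetric irreflexive
   relation e (adjacency) on a finite type T of vertices; symmetry and
   irreflexivity are hypotheses wherever e is used as a graph. *)

(* An edge is an unordered pair, so each one is counted once. *)
Definition edges (T : finType) (e : rel T) : {set {set T}} :=
  [set [set p.1; p.2] | p : T * T & e p.1 p.2].

Definition degree (T : finType) (e : rel T) (u : T) : nat :=
  #|[set v | e u v]|.

Definition avg_degree (R : realType) (T : finType) (e : rel T) : R :=
  2 * #|edges e|%:R / #|T|%:R.

Definition degree_deviation (R : realType) (T : finType) (e : rel T) : R :=
  \sum_(u : T) `| (degree e u)%:R - avg_degree R e |.

Definition adjacency_mx (R : realType) (T : finType) (e : rel T) :
    'M[R]_#|T| :=
  \matrix_(i, j) (e (enum_val i) (enum_val j))%:R.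

(* The largest eigenvalue, given as a relation that determines lam uniquely.
   For a graph with at least one vertex such a lam exists, the adjacency
   matrix being real symmetric. *)
Definition is_spectral_radius (R : realType) (T : finType) (e : rel T)
    (lam : R) : Prop :=
  eigenvalue (adjacency_mx R e) lam /\
  forall mu : R, eigenvalue (adjacency_mx R e) mu -> mu <= lam.

(* Main.v *)
(* With m edges, write V for the variance of the degrees. Let mu be the least
   eigenvalue of the adjacency matrix A and 1 the all-ones vector. Since
   (lam - A)(A - mu) is positive semidefinite, evaluating it at 1 gives
   V <= (lam - d)(d - mu) <= (lam - d)(lam - mu), while
   lam^2 + mu^2 <= tr A^2 = 2m = d n yields lam - mu <= sqrt (2 d n).
   Finally s^2 <= n^2 V by Cauchy-Schwarz. *)
Require Import Defs.
From mathcomp Require Import all_boot all_order all_algebra.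
From mathcomp Require Import reals.
From mathcomp Require Import complex ring lra.
Import Order.TTheory GRing.Theory Num.Theory.
Local Open Scope ring_scope.

(** * Spectral theory of real symmetric matrices *)

Lemma eigenvalue_conj_diag (F : fieldType) (n : nat) (P : 'M[F]_n)
    (d : 'rV[F]_n) (b : F) : P \in unitmx ->
  eigenvalue (invmx P *m diag_mx d *m P) b = [exists i, d 0 i == b].
Proof.
move=> Pu; apply/eigenvalueP/existsP => [[v vA v_neq0] | [i /eqP <-]].
  have vP_neq0 : v *m invmx P != 0.
    by apply: contraNneq v_neq0 => vP0; rewrite -[v](mulmxKV Pu) vP0 mul0mx.
  have [i vPi_neq0] : exists i, (v *m invmx P) 0 i != 0 by apply/rV0Pn.
  exists i; apply/eqP/(mulIf vPi_neq0).
  have /(congr1 (fun u : 'rV_n => (u *m invmx P) 0 i)) := vA.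
  by rewrite -!mulmxA mulmxV // mulmx1 mulmxA mul_mx_diag -scalemxAl !mxE mulrC.
(* Conversely, row [i] of [P] is an eigenvector for [d 0 i]. *)
exists (delta_mx 0 i *m P).
  rewrite !mulmxA mulmxK // scalemxAl; congr (_ *m P).
  by rewrite -rowE row_diag_mx.
apply/eqP => /(congr1 (mulmx^~ (invmx P))); rewrite mulmxK // mul0mx.
by move=> /rowP/(_ i)/eqP; rewrite !mxE !eqxx oner_eq0.
Qed.

Lemma conj_diagX (F : fieldType) (n : nat) (P : 'M[F]_n) (d : 'rV[F]_n)
    (k : nat) : P \in unitmx ->
  (invmx P *m diag_mx d *m P) ^+ k
  = invmx P *m diag_mx (map_mx (fun a => a ^+ k) d) *m P.
Proof.
move=> Pu; elim: k => [|k IHk].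
  rewrite (_ : map_mx _ d = const_mx 1) ?diag_const_mx ?mulmx1 ?mulVmx //.
  by apply/rowP=> i; rewrite !mxE.
rewrite exprS IHk -mulmxE !mulmxA mulmxK // -[_ *m diag_mx d *m _]mulmxA.
rewrite mulmx_diag; congr (_ *m diag_mx _ *m _).
by apply/rowP=> i; rewrite !mxE exprS.
Qed.

Local Open Scope sesquilinear_scope.

Lemma dotmx_diag (C : numClosedFieldType) (n : nat) (y d : 'rV[C]_n) :
  (y *m diag_mx d *m y^t*) 0 0 = \sum_i d 0 i * `|y 0 i| ^+ 2.
Proof.
rewrite mul_mx_diag mxE; apply: eq_bigr => i _.
by rewrite !mxE normCK mulrCA mulrA.
Qed.

(** The spectral theorem, applied to [A] as a Hermitian matrix over the complex extension of [R]:
    the [a i] are the eigenvalues with multiplicity, and [w i] is the squared modulus of the [i]-th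
    coordinate of [x] in a unitary eigenbasis. Recording only these real numbers keeps the complex
    ones out of what follows. *)
Lemma symmetric_spectral_moments (R : rcfType) (n : nat) (A : 'M[R]_n)
    (x : 'rV[R]_n) : A^T = A ->
  exists a w : 'I_n -> R,
    [/\ forall b, eigenvalue A b = [exists i, a i == b],
        forall i, 0 <= w i,
        forall k, (x *m A ^+ k *m x^T) 0 0 = \sum_i a i ^+ k * w i
      & forall k, \tr (A ^+ k) = \sum_i a i ^+ k].
Proof.
move=> A_sym; pose f := real_complex R; pose B := map_mx f A.
have f_real b : f b \is Num.real by rewrite complex_real.
have B_herm : B \is hermsymmx.
  apply: realsym_hermsym; last by apply/mxOverP => i j; rewrite mxE f_real.
  by apply/is_hermitianmxP; rewrite expr0 scale1r map_mx_id // /B map_trmx A_sym.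
have /hermitian_normalmx/orthomx_spectralP := B_herm.
have := spectral_unitarymx B; have := hermitian_spectral_diag_real B_herm.
move: (spectralmx B) (spectral_diag B) => P d d_real P_unitary B_eq.
have Pu := unitarymx_unit P_unitary.
pose a i := complex.Re (d 0 i).
have aE i : f (a i) = d 0 i.
  by apply: RRe_real; move/mxOverP: d_real; apply.
pose y := map_mx f x *m P^t*.
pose w i := complex.Re (`|y 0 i| ^+ 2).
have wE i : f (w i) = `|y 0 i| ^+ 2.
  by apply: RRe_real; rewrite rpredX // normr_real.
have BX k : map_mx f (A ^+ k) = B ^+ k.
  by rewrite rmorphXn.
exists a, w; split.
- move=> b; rewrite -(eigenvalue_map f) -/B B_eq eigenvalue_conj_diag //.
  by apply: eq_existsb => i; rewrite -aE (inj_eq (@complexI R)).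
- by move=> i; rewrite -ler0c -/(f _) wE exprn_ge0.
- move=> k; apply: (@complexI R).
  have -> : (((x *m A ^+ k *m x^T) 0 0)%:C)%C = map_mx f (x *m A ^+ k *m x^T) 0 0.
    by rewrite [RHS]mxE.
  rewrite !map_mxM BX B_eq conj_diagX // invmx_unitary // !mulmxA.
  have -> : map_mx f x^T = (map_mx f x)^t*.
    by apply/matrixP => i j; rewrite !mxE; symmetry; apply: CrealP.
  rewrite -[_ *m P *m _]mulmxA -/y.
  have -> : P *m (map_mx f x)^t* = y^t*.
    by rewrite /y trmx_mul map_mxM trmxCK.
  rewrite dotmx_diag rmorph_sum; apply: eq_bigr => i _.
  by rewrite rmorphM rmorphXn /= -!/(f _) aE wE mxE.
- move=> k; apply: (@complexI R); rewrite -[LHS](trace_map_mx (real_complex R)) BX B_eq.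
  rewrite conj_diagX // mxtrace_mulC mulmxA mulmxV // mul1mx mxtrace_diag.
  by rewrite rmorph_sum; apply: eq_bigr => i _; rewrite mxE rmorphXn /= -/(f _) aE.
Qed.

Local Close Scope sesquilinear_scope.

(** With [mu] the least eigenvalue, the inequalities on [q] are sums, with weights [w i], of
    [mu <= a i <= lam] and [0 <= (lam - a i) * (a i - mu)]. *)
Lemma symmetric_spectral_bounds (R : rcfType) (n : nat) (A : 'M[R]_n)
    (x : 'rV[R]_n) (lam : R) (q := fun k => (x *m A ^+ k *m x^T) 0 0) :
  A^T = A -> eigenvalue A lam ->
  (forall mu, eigenvalue A mu -> mu <= lam) ->
  exists mu, [/\ mu * q 0%N <= q 1%N <= lam * q 0%N,
    q 2%N + lam * mu * q 0%N <= (lam + mu) * q 1%N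
    & mu = lam \/ lam ^+ 2 + mu ^+ 2 <= \tr (A ^+ 2)].
Proof.
move=> A_sym lam_eig lam_max.
have [a [w [eigE w_ge0 qE trE]]] := symmetric_spectral_moments _ _ A x A_sym.
move: (lam_eig); rewrite eigE => /existsP[i0 /eqP a_i0].
have a_le i : a i <= lam by apply: lam_max; rewrite eigE; apply/existsP; exists i.
pose k := [arg min_(i < i0) a i]%O.
have a_ge i : a k <= a i by rewrite /k; case: arg_minP => // j _; apply.
exists (a k); rewrite /q !qE trE; split.
- rewrite !mulr_sumr; apply/andP.
  by split; apply: ler_sum => i _; rewrite expr0 mul1r expr1 ler_wpM2r.
- rewrite !mulr_sumr -big_split; apply: ler_sum => i _ /=.
  have : 0 <= (lam - a i) * (a i - a k) * w i by rewrite !mulr_ge0 ?subr_ge0.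
  by rewrite expr0 expr1; lra.
(* The trace contains both [lam ^+ 2] and [mu ^+ 2] only if they come from different indices; hence
   the alternative [mu = lam]. *)
- have [k_i0 | k_i0] := eqVneq k i0; first by left; rewrite k_i0.
  right; rewrite (bigD1 i0) //= a_i0 lerD2l (bigD1 k) //= lerDl.
  by apply: sumr_ge0 => i _; apply: sqr_ge0.
Qed.

(** * Degrees, edges and moments of the adjacency matrix *)

Lemma set2_eqE (T : finType) (a b c d : T) :
  ([set a; b] == [set c; d]) = ((a, b) \in [set (c, d); (d, c)]).
Proof.
rewrite !inE !xpair_eqE; apply/eqP/orP => [abcd|]; last first.
  by case=> /andP[/eqP-> /eqP->] //; rewrite setUC.
have := set21 a b; have := set22 a b; rewrite {1 2}abcd.
have := set21 c d; have := set22 c d; rewrite -{1 2}abcd !inE.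
do 4![case/pred2P=> ?]; subst; by rewrite !eqxx; auto.
Qed.

(** Double counting of ordered adjacent pairs: the fibre over an edge consists of its two
    orientations, distinct by irreflexivity. *)
Lemma sum_degree (T : finType) (e : rel T) :
  symmetric e -> irreflexive e -> (\sum_u degree e u = #|edges e| * 2)%N.
Proof.
move=> e_sym e_irr.
rewrite -sum_nat_const.
transitivity (\sum_(p in [set p : T * T | e p.1 p.2]) 1)%N.
  under [RHS]eq_bigl do rewrite inE.
  rewrite -(pair_big_dep xpredT e (fun _ _ => 1%N)) /=.
  by under [RHS]eq_bigr do rewrite sum1dep_card.
rewrite (partition_big_imset (fun p : T * T => [set p.1; p.2])).
apply: eq_bigr => _ /imsetP[[a b] /[!inE]/= e_ab ->].
have a_neq_b : (a, b) != (b, a).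
  by apply: contraTneq e_ab => -[-> _]; rewrite e_irr.
rewrite (eq_bigl [in [set (a, b); (b, a)]]); first by rewrite sum1_card cards2 a_neq_b.
move=> [c d]; rewrite inE set2_eqE andb_idl // !inE !xpair_eqE.
by case/orP=> /andP[/eqP-> /eqP->] //; rewrite e_sym.
Qed.

Lemma sum_enum_val (T : finType) (V : nmodType) (F : T -> V) :
  \sum_(i < #|T|) F (enum_val i) = \sum_u F u.
Proof. by rewrite -(big_enum_val F). Qed.

Lemma tr_adjacency_mx (R : realType) (T : finType) (e : rel T) :
  symmetric e -> (adjacency_mx R e)^T = adjacency_mx R e.
Proof. by move=> e_sym; apply/matrixP=> i j; rewrite !mxE e_sym. Qed.

Lemma sum_adjacency_mx (R : realType) (T : finType) (e : rel T) i :
  \sum_j adjacency_mx R e i j = (degree e (enum_val i))%:R.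
Proof.
under eq_bigr do rewrite mxE.
rewrite (sum_enum_val _ _ (fun v => (e (enum_val i) v)%:R)) -natr_sum.
by rewrite -big_mkcond /= sum1dep_card.
Qed.

Lemma ones_adjacency_mx (R : realType) (T : finType) (e : rel T) j :
  symmetric e ->
  ((const_mx 1 : 'rV_#|T|) *m adjacency_mx R e) 0 j
  = (degree e (enum_val j))%:R.
Proof.
move=> e_sym; rewrite mxE -sum_adjacency_mx; apply: eq_bigr => i _.
by rewrite -{1}(tr_adjacency_mx _ _ _ e_sym) !mxE mul1r.
Qed.

Lemma trace_adjacency_mx2 (R : realType) (T : finType) (e : rel T) :
  symmetric e -> \tr (adjacency_mx R e ^+ 2) = (\sum_u degree e u)%:R.
Proof.
move=> e_sym; rewrite natr_sum -(sum_enum_val T); apply: eq_bigr => i _.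
rewrite -sum_adjacency_mx expr2 -mulmxE mxE; apply: eq_bigr => j _.
(* By symmetry each term is the square of an entry, and entries are 0 or 1. *)
by rewrite -{2}(tr_adjacency_mx _ _ _ e_sym) !mxE -natrM mulnb andbb.
Qed.

Lemma adjacency_ones_moments (R : realType) (T : finType) (e : rel T)
    (q := fun k : nat =>
      ((const_mx 1 : 'rV_#|T|) *m adjacency_mx R e ^+ k *m
       (const_mx 1 : 'rV_#|T|)^T) 0 0) :
  symmetric e ->
  [/\ q 0%N = #|T|%:R, q 1%N = (\sum_u degree e u)%:R
    & q 2%N = \sum_u (degree e u)%:R ^+ 2].
Proof.
move=> e_sym; split; rewrite /q.
- rewrite mulmx1 mxE; under eq_bigr do rewrite !mxE mul1r.
  by rewrite sumr_const card_ord.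
- rewrite expr1 mxE natr_sum -(sum_enum_val T); apply: eq_bigr => i _.
  by rewrite ones_adjacency_mx // !mxE mulr1.
(* By symmetry this is the squared norm of the all-ones row times [A], whose entries are the
   degrees. *)
- rewrite expr2 -mulmxE mulmxA -{2}(tr_adjacency_mx _ _ _ e_sym) -mulmxA.
  rewrite -trmx_mul mxE -(sum_enum_val T); apply: eq_bigr => i _.
  by rewrite [X in _ * X]mxE ones_adjacency_mx // expr2.
Qed.

(** * Degree deviation and the final estimate *)

Lemma sqr_sum_le (R : realFieldType) (T : finType) (F : T -> R) :
  (\sum_u F u) ^+ 2 <= #|T|%:R * \sum_u F u ^+ 2.
Proof.
have : 0 <= \sum_u \sum_v (F u - F v) ^+ 2.
  by do 2!apply: sumr_ge0 => ? _; apply: sqr_ge0.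
(* Lagrange's identity: the double sum is twice the gap in the Cauchy-Schwarz inequality. *)
have -> : \sum_u \sum_v (F u - F v) ^+ 2
    = #|T|%:R * (\sum_u F u ^+ 2) *+ 2 - (\sum_u F u) ^+ 2 *+ 2.
  transitivity (\sum_u \sum_v (F u ^+ 2 + F v ^+ 2 - F u * F v *+ 2)).
    by do 2!apply: eq_bigr => ? _; ring.
  under eq_bigr do rewrite sumrB big_split sumr_const sumrMnl -mulr_sumr /=.
  rewrite sumrB big_split /= sumr_const !sumrMnl -mulr_suml.
  by rewrite -(mulr_natl _ #|_|); ring.
by lra.
Qed.

Lemma degree_deviation_sqr_le (R : realType) (T : finType) (e : rel T)
    (d := avg_degree R e) :
  symmetric e -> irreflexive e ->
  degree_deviation R e ^+ 2
    <= #|T|%:R * (\sum_u (degree e u)%:R ^+ 2 - #|T|%:R * d ^+ 2).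
Proof.
move=> e_sym e_irr; apply: le_trans (sqr_sum_le _ _ _) _.
have [T0 | T_neq0] := eqVneq #|T| 0%N; first by rewrite T0 !mul0r.
rewrite ler_wpM2l // -/d le_eqVlt; apply/orP; left; apply/eqP.
transitivity (\sum_u ((degree e u)%:R ^+ 2 - 2 * d * (degree e u)%:R + d ^+ 2)).
  by apply: eq_bigr => u _; rewrite real_normK ?num_real //; ring.
rewrite big_split sumrB /= -mulr_sumr -natr_sum sum_degree // sumr_const.
have -> : (#|edges e| * 2)%:R = #|T|%:R * d.
  by rewrite /d /avg_degree mulrC divfK ?pnatr_eq0 // natrM mulrC.
by rewrite -mulr_natl; ring.
Qed.

Theorem theorem9 (R : realType) (T : finType) (e : rel T)
    (e_sym : symmetric e) (e_irr : irreflexive e)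
    (n : nat) (d s lam : R)
    (n_def : n = #|T|)
    (d_def : d = avg_degree R e)
    (s_def : s = degree_deviation R e)
    (s_gt0 : 0 < s)
    (lam_def : is_spectral_radius e lam) :
  d + (Num.sqrt 2 * s ^+ 2) / (2 * n%:R ^+ 2 * Num.sqrt (d * n%:R)) <= lam.
Proof.
have [lam_eig lam_max] := lam_def.
have [q0 q1 q2] := adjacency_ones_moments R _ _ e_sym.
have [mu []] := symmetric_spectral_bounds _ _ _ (const_mx 1) _
  (tr_adjacency_mx _ _ _ e_sym) lam_eig lam_max.
rewrite q0 q1 q2 trace_adjacency_mx2 // sum_degree //.
have := degree_deviation_sqr_le R _ _ e_sym e_irr.
rewrite -s_def -d_def -n_def.
(* A positive deviation forces a vertex to exist, so dividing by [n] is legitimate. *)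
have n_gt0 : 0 < n%:R :> R.
  rewrite ltr0n lt0n; apply: contraTneq s_gt0 => n0.
  by rewrite s_def /degree_deviation big_pred0 ?ltxx // => u;
    have := fintype0 u; rewrite -n_def n0 => /(_ erefl).
have -> : (#|edges e| * 2)%:R = d * n%:R.
  by rewrite d_def /avg_degree -n_def divfK ?gt_eqF // natrM mulrC.
rewrite [lam * n%:R]mulrC [mu * n%:R]mulrC [d * n%:R]mulrC !ler_pM2l //.
set N := n%:R in n_gt0 *; set Q := \sum_u _.
move=> s_le /andP[mu_le_d d_le_lam] Q_le mu_lam.
have s2_gt0 : 0 < s ^+ 2 by rewrite exprn_gt0.
have s2_le : s ^+ 2 <= N ^+ 2 * ((lam - d) * (d - mu)).
  rewrite (le_trans s_le) // expr2 -mulrA ler_pM2l //.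
  by rewrite -subr_ge0 in Q_le; nra.
(* If [mu = lam], then [d] equals both and [s2_le] gives [s ^+ 2 <= 0], a contradiction. *)
have {mu_lam} mu_lam : lam ^+ 2 + mu ^+ 2 <= N * d.
  case: mu_lam => // mu_lam; move: s2_le; rewrite leNgt => /negP[].
  apply: le_lt_trans s2_gt0; rewrite mu_lam in mu_le_d.
  by have -> : lam = d; [apply/le_anti/andP | rewrite subrr mul0r mulr0].
have lam_mu : lam - mu <= Num.sqrt 2 * Num.sqrt (N * d).
  rewrite -sqrtrM // (le_trans (ler_norm _)) // -sqrtr_sqr ler_wsqrtr //.
  (* [(lam - mu) ^+ 2 = 2 * (lam ^+ 2 + mu ^+ 2) - (lam + mu) ^+ 2]. *)
  by have := sqr_ge0 (lam + mu); nra.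
have s2_le' : s ^+ 2 <= N ^+ 2 * ((lam - d) * (Num.sqrt 2 * Num.sqrt (N * d))).
  apply: le_trans s2_le _; rewrite ler_wpM2l ?sqr_ge0 // ler_wpM2l ?subr_ge0 //.
  by apply: le_trans lam_mu; rewrite lerD2r.
(* The denominator is nonzero: otherwise [s2_le'] would again give [s ^+ 2 <= 0]. *)
have sqrt_gt0 : 0 < Num.sqrt (N * d).
  rewrite lt_def sqrtr_ge0 andbT; apply: contraTneq s2_le' => ->.
  by rewrite !mulr0 -ltNge.
rewrite -lerBrDl ler_pdivrMr; last by rewrite !mulr_gt0 ?exprn_gt0.
apply: le_trans (ler_wpM2l (sqrtr_ge0 2) s2_le') _.
rewrite le_eqVlt; apply/orP; left; apply/eqP.
(* Writing 2 as the square of its root leaves a polynomial identity. *)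
rewrite -[2 in RHS](sqr_sqrtr (ler0n R 2)); ring.
Qed.
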